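(* Let $p,q,r\in\mathcal{P}_d(\mathbb{R})$. Then (1) $d_K(p\boxplus_d r,q\boxplus_d r)\le d_K(p,q)$; (2) $d_L(p\boxplus_d r,q\boxplus_d r)\le d_L(p,q)$.
   Context: $\mathcal{P}_d(\mathbb{R})$: monic real-rooted polynomials of degree $d$. For $p$ with roots $\lambda_i$, $p(x)=\sum_{k=0}^d(-1)^k\binom{d}{k}\tilde e_k(p)x^{d-k}$ with $\tilde e_k(p)=\binom{d}{k}^{-1}e_k(\lambda_1,\dots,\lambda_d)$; $p\boxplus_d q$ is defined by $\tilde e_k(p\boxplus_d q)=\sum_{i=0}^k\binom{k}{i}\tilde e_i(p)\tilde e_{k-i}(q)$. $\mu_p=\frac1d\sum_i\delta_{\lambda_i}$ and $\mathcal{F}_p$ is its CDF. For probability measures $\mu,\nu$ on $\mathbb{R}$: Kolmogorov distance $d_K(\mu,\nu)=\inf\{\epsilon>0:\mathcal{F}_\mu(x)-\epsilon\le\mathcal{F}_\nu(x)\le\mathcal{F}_\mu(x)+\epsilon\ \forall x\}$; Lévy distance $d_L(\mu,\nu)=\inf\{\epsilon>0:\mathcal{F}_\mu(x-\epsilon)-\epsilon\le\mathcal{F}_\nu(x)\le\mathcal{F}_\mu(x+\epsilon)+\epsilon\ \forall x\}$. For polynomials, $d_K(p,q):=d_K(\mu_p,\mu_q)$ and $d_L(p,q):=d_L(\mu_p,\mu_q)$. *)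

(* Defs.v *)
From HB Require Import structures.
From mathcomp Require Import all_boot all_order all_algebra.
From mathcomp Require Import classical_sets reals.
Set Implicit Arguments. Unset Strict Implicit. Unset Printing Implicit Defensive.
Import Order.TTheory GRing.Theory Num.Theory.
Local Open Scope ring_scope.
Local Open Scope classical_set_scope.

Section FiniteFree.
Variable R : realType.

Definition has_roots (p : {poly R}) (s : seq R) : Prop :=
  p = \prod_(x <- s) ('X - x%:P).

Definition Pd (d : nat) (p : {poly R}) : Prop :=
  exists s : seq R, size s = d /\ has_roots p s.

(* normalized elementary symmetric polynomial of the roots, read off the
   coefficients: p(x) = sum_k (-1)^k C(d,k) et_k(p) x^(d-k) *)
Definition etilde (d : nat) (p : {poly R}) (k : nat) : R :=
  (-1) ^+ k * p`_(d - k) / ('C(d, k))%:R.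

Definition ffconv (d : nat) (p q : {poly R}) : {poly R} :=
  \sum_(k < d.+1)
     ((-1) ^+ k * ('C(d, k))%:R *
      (\sum_(i < k.+1) ('C(k, i))%:R * etilde d p i * etilde d q (k - i)))
       *: 'X^(d - k).

Definition rootseq (p : {poly R}) : seq R := xget [::] [set s | has_roots p s].

Definition cdf (d : nat) (p : {poly R}) (x : R) : R :=
  (count (fun y => y <= x) (rootseq p))%:R / d%:R.

Definition dK (F G : R -> R) : R :=
  inf [set e : R | 0 < e /\ forall x, F x - e <= G x /\ G x <= F x + e].

Definition dL (F G : R -> R) : R :=
  inf [set e : R | 0 < e /\
         forall x, F (x - e) - e <= G x /\ G x <= F (x + e) + e].

Definition dKp (d : nat) (p q : {poly R}) : R := dK (cdf d p) (cdf d q).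
Definition dLp (d : nat) (p q : {poly R}) : R := dL (cdf d p) (cdf d q).

End FiniteFree.

(* Main.v *)
Require Import Defs.
From HB Require Import structures.
From mathcomp Require Import all_boot all_order all_algebra.
From mathcomp Require Import complex ring lra zify.
From mathcomp Require Import classical_sets reals.
Set Implicit Arguments. Unset Strict Implicit. Unset Printing Implicit Defensive.
Import Order.TTheory GRing.Theory Num.Theory.
Local Open Scope ring_scope.

(* Write p = (X - a) f. As a function of a, the convolution p [+] r is an
   affine pencil A - a B with B = f [+] r, and the zeros of B interlace those of
   A - a B; hence replacing one root of p by a larger one moves every root of
   p [+] r to the right, but past at most one of its neighbours. So if the
   counting functions of p and q satisfy N_p <= N_q + n, then moving the i-th
   root of q to the (i + n)-th root of p and the remaining n roots arbitrarily
   gives N_(p [+] r) <= N_(q [+] r) + n. This one-sided bound yields (1), and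
   also (2) since [+] commutes with translations.

   Interlacing is expressed by partial fractions: F = prod (X - x) and
   B = sum_x v_x F / (X - x) with v >= 0. It is proved by induction on the
   degree: with g = r' / d, one has r = (X - c) g - sum_y w_y g / (X - y) with
   w >= 0, so that p [+]_d r = (X - a - c) (f [+] g) - sum_y w_y (f [+] g/(X - y)),
   convolutions on the right being in degree d - 1, where each f [+] g/(X - y)
   interlaces f [+] g. The passage between the two partial fraction forms holds
   since the functions involved map the upper half-plane to itself. *)

(** * Polynomials given by root lists, and partial fractions *)

Section RootPolynomials.
Variable R : fieldType.
Implicit Types (s t u : seq R) (v w : R -> R).

Definition rpoly s : {poly R} := \prod_(x <- s) ('X - x%:P).

(** This is [rpoly s] times the rational function [\sum_x v x / (X - x)]. *)
Definition wsum v s : {poly R} := \sum_(x <- undup s) v x *: rpoly (rem x s).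

Lemma rpoly_cons x s : rpoly (x :: s) = ('X - x%:P) * rpoly s.
Proof. by rewrite /rpoly big_cons. Qed.

Lemma rpoly_cat s t : rpoly (s ++ t) = rpoly s * rpoly t.
Proof. by rewrite /rpoly big_cat. Qed.

Lemma rpoly_perm s t : perm_eq s t -> rpoly s = rpoly t.
Proof. by move=> h; apply: perm_big. Qed.

Lemma rpoly_inj s t : rpoly s = rpoly t -> perm_eq s t.
Proof. exact: prod_XsubC_eq. Qed.

Lemma size_rpoly s : size (rpoly s) = (size s).+1.
Proof. exact: size_prod_XsubC. Qed.

Lemma monic_rpoly s : rpoly s \is monic.
Proof. exact: monic_prod_XsubC. Qed.

Lemma root_rpoly s x : root (rpoly s) x = (x \in s).
Proof. exact: root_prod_XsubC. Qed.

Lemma rpoly_rem x s : x \in s -> rpoly s = ('X - x%:P) * rpoly (rem x s).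
Proof. by move=> xs; rewrite -rpoly_cons; apply/rpoly_perm/perm_to_rem. Qed.

Lemma deriv_rpoly s : (rpoly s)^`() = \sum_(x <- s) rpoly (rem x s).
Proof.
elim: s => [|a s IHs]; first by rewrite /rpoly !big_nil derivC.
rewrite rpoly_cons derivM derivXsubC mul1r IHs big_cons /= eqxx mulr_sumr.
congr (_ + _); apply: eq_big_seq => x xs.
case: eqVneq => [->|_]; last by rewrite rpoly_cons.
by rewrite (rpoly_rem xs).
Qed.

Lemma horner_deriv_rpoly s x :
  x \in s -> (rpoly s)^`().[x] = (rpoly (rem x s)).[x].
Proof.
move=> xs; rewrite (rpoly_rem xs) derivM derivXsubC mul1r hornerD hornerM.
by rewrite hornerXsubC subrr mul0r addr0.
Qed.

Lemma wsum_uniq v u : uniq u -> wsum v u = \sum_(x <- u) v x *: rpoly (rem x u).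
Proof. by move=> uu; rewrite /wsum undup_id. Qed.

Lemma wsum_perm v s t : perm_eq s t -> wsum v s = wsum v t.
Proof.
move=> st; rewrite /wsum (perm_big (undup t)) /=; last first.
  by apply: perm_undup; apply: perm_mem.
apply: eq_big_seq => x; rewrite mem_undup -(perm_mem st) => xs; congr (_ *: _).
apply: (mulfI (_ : 'X - x%:P != 0)); first by rewrite polyXsubC_eq0.
by rewrite -!rpoly_rem -?(perm_mem st) //; apply: rpoly_perm.
Qed.

Lemma eq_wsum v w s : {in s, v =1 w} -> wsum v s = wsum w s.
Proof.
by move=> vw; apply: eq_big_seq => x; rewrite mem_undup => /vw ->.
Qed.

Lemma wsumD v w s : wsum (fun x => v x + w x) s = wsum v s + wsum w s.
Proof. by rewrite -big_split; apply: eq_bigr => x _; rewrite scalerDl. Qed.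

Lemma wsumZ c v s : wsum (fun x => c * v x) s = c *: wsum v s.
Proof. by rewrite scaler_sumr; apply: eq_bigr => x _; rewrite scalerA. Qed.

Lemma deriv_rpoly_wsum s :
  (rpoly s)^`() = wsum (fun x => (count_mem x s)%:R) s.
Proof.
rewrite deriv_rpoly -big_undup_iterop_count; apply: eq_bigr => x _.
by rewrite -[iterop _ _ _ _]/(_ *+ _) scaler_nat.
Qed.

Lemma size_wsum_rem v u s : {subset u <= s} ->
  (size (\sum_(x <- u) v x *: rpoly (rem x s))%R <= size s)%N.
Proof.
move=> us; rewrite big_seq; apply: (leq_trans (size_sum _ _ _)).
apply/bigmax_leqP_seq => x xu _; have xs := us _ xu.
apply: leq_trans (size_scale_leq (v x) (rpoly (rem x s))) _.
by rewrite size_rpoly size_rem // prednK //; case: (s) xs.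
Qed.

Lemma size_wsum v s : (size (wsum v s) <= size s)%N.
Proof. by apply: size_wsum_rem => x; rewrite mem_undup. Qed.

(* [k] may repeat roots of [u]; this is why the sum defining [wsum] ranges over
   the distinct roots only. *)
Lemma wsum_cat w u k : uniq u ->
  wsum w u * rpoly k = wsum (fun x => if x \in u then w x else 0) (u ++ k).
Proof.
move=> uu; rewrite wsum_uniq // mulr_suml /wsum.
rewrite [RHS](bigID (mem u)) /= [X in _ = _ + X]big1 ?addr0; last first.
  by move=> x /negbTE ->; rewrite scale0r.
rewrite -[RHS]big_filter [RHS](perm_big u) /=; last first.
  apply: uniq_perm => // [|x]; first by rewrite filter_uniq ?undup_uniq.
  by rewrite mem_filter mem_undup mem_cat; case: (x \in u).
apply: eq_big_seq => x xu; rewrite xu -scalerAl; congr (_ *: _).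
rewrite -rpoly_cat; apply: rpoly_perm.
rewrite -(perm_cons x) -cat_cons perm_sym.
apply: perm_trans (_ : perm_eq (u ++ k) _); last first.
  by rewrite perm_cat2r perm_to_rem.
by rewrite perm_sym perm_to_rem // mem_cat xu.
Qed.

(** Lagrange interpolation: both sides have degree below [size t] and agree on [t]. The weights are
    the residues of [A / rpoly t]. *)
Lemma lagrange_wsum t (A : {poly R}) : uniq t -> (size A <= size t)%N ->
  A = wsum (fun x => A.[x] / (rpoly t)^`().[x]) t.
Proof.
move=> ut sA; apply/eqP; rewrite -subr_eq0; apply/eqP.
apply: (roots_geq_poly_eq0 (rs := t)) => //; last first.
  by rewrite (leq_trans (size_polyD _ _)) // size_polyN geq_max sA size_wsum.
apply/allP => x xt; rewrite /root !hornerE wsum_uniq // horner_sum.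
rewrite (bigD1_seq x) //= big1_seq => [|y /andP[yx yt]]; last first.
  rewrite hornerZ (_ : (rpoly _).[x] = 0) ?mulr0 //; apply/rootP.
  by rewrite root_rpoly mem_rem_uniq // !inE eq_sym yx.
rewrite hornerZ horner_deriv_rpoly // addr0 divfK ?subrr //.
by rewrite -/(root _ _) root_rpoly mem_rem_uniq // !inE eqxx.
Qed.

End RootPolynomials.

(** * Real and simple zeros of partial fraction pencils *)

Section RealRooted.
Variable R : rcfType.
Implicit Types (s t u : seq R) (v w : R -> R).

Lemma real_roots_split (N : {poly R}) :
  (forall z : R[i], root (map_poly (real_complex R) N) z -> complex.Im z = 0) ->
  exists t, N = lead_coef N *: rpoly t.
Proof.
move=> Nreal; have [->|N0] := eqVneq N 0.
  by exists [::]; rewrite lead_coef0 scale0r.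
have [r Nr] := closed_field_poly_normal (map_poly (real_complex R) N).
exists (map (@complex.Re R) r); apply: (map_inj_poly (f := real_complex R)) => //.
  exact: complexI.
rewrite [LHS]Nr map_polyZ /= lead_coef_map; congr (_ *: _).
rewrite /rpoly map_prod_XsubC big_map; apply: eq_big_seq => z zr.
congr ('X - _%:P); have : complex.Im z = 0.
  apply: Nreal; rewrite Nr rootZ ?root_prod_XsubC //.
  by rewrite lead_coef_map fmorph_eq0 lead_coef_eq0.
by case: z {zr} => a b /= ->.
Qed.

Section Pencil.
Local Notation c := (real_complex _).
Variables (a b : R) (u : seq R) (v : R -> R).
Hypotheses (uu : uniq u) (v0 : {in u, forall x, 0 < v x}) (a0 : 0 <= a).
(** This keeps [N / D] from being constant, so that its derivative is positive off the poles. *)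
Hypothesis au : (0 < a) || (u != [::]).

Let D := rpoly u.
Let N := (a *: 'X + b%:P) * D - wsum v u.

(* At a non-real zero [z], the imaginary part of [N(z)/D(z)] would be
   [Im z * (a + \sum_x v x / |z - x|^2)]. *)
Lemma pencil_real_root (z : R[i]) :
  root (map_poly (real_complex R) N) z -> complex.Im z = 0.
Proof.
move=> rz; apply/eqP; apply: contraT => Imz.
(* [J] is complex conjugation, kept abstract behind the three properties used below. *)
have [J [cR JJ JIm]] : exists J : {rmorphism R[i] -> R[i]},
  [/\ forall x, J (c x) = c x, forall z, 0 <= z * J z
    & forall z, complex.Im z != 0 -> z - J z != 0].
  exists (@conjc R : {rmorphism _ -> _}).
  split=> [x|y|y Imy]; [exact: conjc_real|exact: mulcJ_ge0|].
  have -> : y - (@conjc R : {rmorphism _ -> _}) y = _ := subcJ y.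
  by rewrite !mulf_neq0 ?pnatr_eq0 ?fmorph_eq0 // eq_complex /= oner_eq0 andbF.
have zx (x : R) : z - c x != 0.
  apply: contraNneq Imz => /eqP; rewrite subr_eq0 => /eqP ->; by [].
have czx (x : R) : J z - c x = J (z - c x).
  by rewrite rmorphB /= cR.
have Dz (s : seq R) : (map_poly c (rpoly s)).[z] = \prod_(x <- s) (z - c x).
  rewrite /rpoly map_prod_XsubC horner_prod.
  by apply: eq_bigr => x _; rewrite hornerXsubC.
have Dz0 : (map_poly c D).[z] != 0.
  by rewrite Dz; elim/big_rec: _ => [|x y _ y0]; rewrite ?oner_eq0 ?mulf_neq0.
have e1 : c a * z + c b = \sum_(x <- u) c (v x) / (z - c x).
  move/rootP: rz; rewrite /N rmorphB rmorphM rmorphD /= map_polyZ map_polyX.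
  rewrite map_polyC /= hornerD hornerN hornerM !hornerE => /eqP.
  rewrite subr_eq0 => /eqP e; apply: (mulIf Dz0); rewrite e.
  rewrite wsum_uniq // rmorph_sum /= horner_sum mulr_suml.
  apply: eq_big_seq => x xu; rewrite map_polyZ hornerZ /D (rpoly_rem xu).
  by rewrite rmorphM /= hornerM map_polyXsubC hornerXsubC mulrA divfK.
have e2 : c a * J z + c b = \sum_(x <- u) c (v x) / (J z - c x).
  have := congr1 J e1; rewrite rmorphD rmorphM /= !cR => ->.
  rewrite rmorph_sum; apply: eq_bigr => x _.
  by rewrite fmorph_div rmorphB /= !cR.
have cz := JIm _ Imz.
(* Divide the difference of [e1] and its conjugate by [z - J z]: nonnegative terms add up to zero,
   which [au] forbids. *)
have e3 : c a + \sum_(x <- u) c (v x) / ((z - c x) * (J z - c x)) = 0.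
  apply: (mulIf cz); rewrite mul0r mulrDl mulr_suml.
  have -> : c a * (z - J z) = (c a * z + c b) - (c a * J z + c b) by ring.
  rewrite e1 e2 -sumrB -big_split /= big1 // => x _.
  have := zx x; have : J z - c x != 0 by rewrite czx fmorph_eq0.
  by move=> h1 h2; field; rewrite h1.
have tpos x : x \in u -> 0 < c (v x) / ((z - c x) * (J z - c x)).
  move=> xu; rewrite divr_gt0 //; first by rewrite /c ltcR v0.
  by rewrite lt_def czx JJ andbT mulf_neq0 ?fmorph_eq0.
have a0' : 0 <= c a by rewrite ler0c.
move/eqP: e3; rewrite paddr_eq0 //; last first.
  by rewrite big_seq; apply: sumr_ge0 => x /tpos /ltW.
case/andP=> ca0; case: (u) tpos au => [|x u'] tpos /=.
  by rewrite orbF; move: ca0; rewrite fmorph_eq0 => /eqP ->; rewrite ltxx.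
move=> _; rewrite big_cons paddr_eq0 ?(ltW (tpos _ (mem_head _ _))) //.
  by rewrite (gt_eqF (tpos _ (mem_head _ _))).
rewrite big_seq; apply: sumr_ge0 => y yu.
by rewrite ltW // tpos // inE yu orbT.
Qed.

(** Only the term at [x] survives in [wsum v u], so that [N(x) = - v x * D'(x)]. *)
Lemma pencil_pole_sign x : x \in u -> D^`().[x] * N.[x] < 0.
Proof.
move=> xu; have Dx : D.[x] = 0 by apply/rootP; rewrite root_rpoly.
have rx : (rpoly (rem x u)).[x] != 0.
  by rewrite -/(root _ _) root_rpoly mem_rem_uniq // !inE eqxx.
have -> : N.[x] = - (v x * (rpoly (rem x u)).[x]).
  rewrite /N !hornerE Dx mulr0 sub0r wsum_uniq // horner_sum.
  rewrite (bigD1_seq x) //= big1_seq ?addr0 ?hornerZ // => y /andP[yx yu].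
  rewrite hornerZ (_ : (rpoly _).[x] = 0) ?mulr0 //; apply/rootP.
  by rewrite root_rpoly mem_rem_uniq // !inE eq_sym yx.
rewrite horner_deriv_rpoly // mulrN oppr_lt0 mulrCA mulr_gt0 ?v0 //.
by rewrite -expr2 exprn_even_gt0 // rx orbT.
Qed.

Lemma pencil_zero_pole x : root N x -> D.[x] != 0.
Proof.
move=> rx; rewrite -/(root _ _) root_rpoly; apply/negP => xu.
by have := pencil_pole_sign xu; rewrite (rootP rx) mulr0 ltxx.
Qed.

(* [(N/D)' = a + \sum_x v x / (X - x)^2] away from the poles. *)
Lemma pencil_zero_sign y : root N y -> 0 < N^`().[y] * D.[y].
Proof.
move=> ry; have Dy := pencil_zero_pole ry.
have yx x : x \in u -> y - x != 0.
  by move=> xu; apply: contraNneq Dy => /eqP; rewrite subr_eq0 => /eqP ->;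
     rewrite -/(root _ _) root_rpoly.
have rem1 x : x \in u -> (rpoly (rem x u)).[y] = D.[y] / (y - x).
  by move=> xu; rewrite /D (rpoly_rem xu) hornerM hornerXsubC mulrC mulKf ?yx.
have rem2 x : x \in u -> (rpoly (rem x u))^`().[y]
    = D^`().[y] / (y - x) - D.[y] / (y - x) ^+ 2.
  move=> xu; have : D^`().[y] = D.[y] / (y - x) + (y - x) * (rpoly (rem x u))^`().[y].
    by rewrite {1}/D (rpoly_rem xu) derivM derivXsubC mul1r hornerD rem1 // hornerM hornerXsubC.
  by move=> ->; have := yx x xu => h; field.
have Ny : (a * y + b) = \sum_(x <- u) v x / (y - x).
  move/rootP: ry; rewrite /N !hornerE => /eqP; rewrite subr_eq0 => /eqP e.
  apply: (mulIf Dy); rewrite e wsum_uniq // horner_sum mulr_suml.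
  by apply: eq_big_seq => x xu; rewrite hornerZ rem1 // mulrA mulrAC.
have -> : N^`().[y] * D.[y] =
    D.[y] ^+ 2 * (a + \sum_(x <- u) v x / (y - x) ^+ 2).
  rewrite /N derivB derivM derivD derivZ derivX derivC addr0 wsum_uniq // raddf_sum /=.
  rewrite !hornerE horner_sum Ny.
  under [X in _ - X]eq_big_seq => x xu do
    rewrite derivZ hornerZ rem2 // mulrBr mulrCA [v x * (D.[y] / _)]mulrCA.
  rewrite sumrB -!mulr_sumr; ring.
have tpos x : x \in u -> 0 < v x / (y - x) ^+ 2.
  by move=> xu; rewrite divr_gt0 ?v0 // exprn_even_gt0 //= yx.
rewrite mulr_gt0 ?exprn_even_gt0 ?Dy //=.
case/orP: au => [a1|].
  by rewrite ltr_wpDr // big_seq; apply: sumr_ge0 => x /tpos /ltW.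
case: (u) tpos => // x u' tpos _; rewrite ltr_wpDl // big_cons.
rewrite ltr_pwDl ?tpos ?mem_head // big_seq; apply: sumr_ge0 => z zu.
by rewrite ltW // tpos // inE zu orbT.
Qed.

(** A repeated zero would make [N'] vanish there, against [pencil_zero_sign]. *)
Lemma pencil_split : exists2 t, N = lead_coef N *: rpoly t & uniq t.
Proof.
have [t Nt] := real_roots_split pencil_real_root; exists t => //.
apply/count_mem_uniq => x; have [xt|/count_memPn //] := boolP (x \in t).
have N0 : N != 0.
  apply/negP => /eqP N0; have r z : root N z by rewrite N0 root0.
  by have := pencil_zero_sign (r 0); rewrite N0 deriv0 hornerC mul0r ltxx.
have /pencil_zero_sign : root N x by rewrite Nt rootZ ?lead_coef_eq0 // root_rpoly.
rewrite Nt derivZ hornerZ horner_deriv_rpoly // => h.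
have : x \notin rem x t.
  by rewrite -root_rpoly /root; apply: contraTneq h => ->; rewrite mulr0 mul0r ltxx.
move/count_memPn; rewrite count_rem xt /= eqxx.
by have : (0 < count_mem x t)%N by [rewrite -has_count has_pred1]; case: count => // -[].
Qed.

End Pencil.
End RealRooted.

(** * Interlacing cones *)

Section Cone.
Variable R : rcfType.
Implicit Types (s t u m : seq R) (v w : R -> R).

(* [cone s B]: the zeros of [B] interlace [s], with all multiplicities
   allowed, and [B] has degree less than [size s]. *)
Definition cone s (B : {poly R}) : Prop :=
  exists2 v, {in s, forall x, 0 <= v x} & B = wsum v s.

Lemma cone_perm s t B : perm_eq s t -> cone s B -> cone t B.
Proof.
move=> st [v v0 ->]; exists v; last exact: wsum_perm.
by move=> x; rewrite -(perm_mem st); apply: v0.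
Qed.

Lemma cone0 s : cone s 0.
Proof. by exists (fun=> 0) => //; rewrite /wsum big1 // => x _; rewrite scale0r. Qed.

Lemma coneD s A B : cone s A -> cone s B -> cone s (A + B).
Proof.
move=> [v v0 ->] [w w0 ->]; exists (fun x => v x + w x); last by rewrite wsumD.
by move=> x xs; rewrite addr_ge0 ?v0 ?w0.
Qed.

Lemma coneZ s a B : 0 <= a -> cone s B -> cone s (a *: B).
Proof.
move=> a0 [v v0 ->]; exists (fun x => a * v x); last by rewrite wsumZ.
by move=> x xs; rewrite mulr_ge0 ?v0.
Qed.

Lemma cone_sum s (I : eqType) (r : seq I) (F : I -> {poly R}) :
  {in r, forall i, cone s (F i)} -> cone s (\sum_(i <- r) F i).
Proof.
move=> cF; rewrite big_seq; elim/big_ind: _ => //; first exact: cone0.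
exact: coneD.
Qed.

Lemma cone_cat u k w : uniq u -> {in u, forall x, 0 <= w x} ->
  cone (u ++ k) (wsum w u * rpoly k).
Proof.
move=> uu w0; exists (fun x => if x \in u then w x else 0); last exact: wsum_cat.
by move=> x _; case: ifP => // /w0.
Qed.

(** Zero weights and repeated roots give factors common to [rpoly s] and [wsum v s]. Collecting them
    in [k] leaves distinct poles with positive weights, as the pencil lemmas require. *)
Lemma wsum_reduce s v : {in s, forall x, 0 <= v x} ->
  exists u k, [/\ uniq u, {in u, forall x, 0 < v x}, perm_eq s (u ++ k)
    & wsum v s = wsum v u * rpoly k].
Proof.
move=> v0; pose u := [seq x <- undup s | 0 < v x].
have uu : uniq u by rewrite filter_uniq ?undup_uniq.
have [k sk] : {k | perm_eq s (u ++ k)}.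
  by apply: perm_to_subseq; apply: subseq_trans (filter_subseq _ _) (undup_subseq _).
exists u, k; split=> //; first by move=> x; rewrite mem_filter => /andP[].
rewrite wsum_cat // (wsum_perm _ sk); apply: eq_wsum => x.
rewrite -(perm_mem sk) => xs; rewrite mem_filter mem_undup xs andbT.
by rewrite lt_neqAle v0 // andbT; case: eqVneq.
Qed.

Lemma monic_pencil u w (A : {poly R}) : A \is monic -> size A = (size u).+1 ->
  A - wsum w u \is monic /\ size (A - wsum w u) = (size u).+1.
Proof.
move=> mA sA; have h : (size (- wsum w u) < size A)%N.
  by rewrite size_polyN sA ltnS size_wsum.
by rewrite monicE lead_coefDl // size_polyDl // -monicE.
Qed.

Lemma monic_division_step (A B : {poly R}) : A \is monic -> B \is monic ->
  size A = (size B).+1 ->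
  exists c, (size (A - ('X - c%:P) * B)%R < size B)%N.
Proof.
(* In degree [(size B).-1] the coefficient of [A - X B] is [- c] and that of [c B] is [c]; one
   degree higher, both leading terms are monic and cancel. *)
move=> mA mB sA; exists (('X * B)`_(size B).-1 - A`_(size B).-1).
have B0 : (0 < size B)%N by rewrite size_poly_gt0 monic_neq0.
have A1 : A`_(size B) = 1 by move/monicP: mA; rewrite lead_coefE sA.
have B1 : B`_(size B).-1 = 1 by move/monicP: mB.
rewrite -(prednK B0) ltnS; apply/leq_sizeP => j.
rewrite prednK // leq_eqVlt => /orP[/eqP <-|jB].
  by rewrite mulrBl coefB coefB coefCM B1; ring.
have {}jB : (size B <= j)%N by rewrite -(prednK B0).
have Bj : B`_j = 0 by rewrite nth_default.
rewrite mulrBl !coefB coefCM Bj mulr0 subr0 coefXM.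
have -> : (j == 0)%N = false by rewrite gtn_eqF // (leq_trans B0).
have [->|nj] := eqVneq j (size B); first by rewrite A1 B1 subrr.
have Bj' : (size B < j)%N by rewrite ltn_neqAle eq_sym nj.
by rewrite !nth_default ?subrr ?sA // -ltnS (ltn_predK Bj').
Qed.

(** Up to common factors, [- B / rpoly s] maps the upper half-plane to itself, hence so does its
    negative inverse [rpoly s / B]. The latter is [X - c] plus a proper fraction, whose residues at
    the zeros of [B] are therefore not positive. *)
Lemma cone_quotient s B : cone s B -> B \is monic -> size B = size s ->
  exists t c w, [/\ B = rpoly t, {in t, forall x, 0 <= w x}
    & rpoly s = ('X - c%:P) * rpoly t - wsum w t].
Proof.
move=> [v v0 ->] mB sB; have [u [k [uu u0 sk Bk]]] := wsum_reduce v0.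
have sk_eq : size s = (size u + size k)%N by rewrite (perm_size sk) size_cat.
set Q := wsum v u in Bk; have mQ : Q \is monic.
  by move: mB; rewrite Bk monicMr // monic_rpoly.
have sQ : size Q = size u.
  move: sB; rewrite Bk size_Mmonic ?monic_rpoly ?monic_neq0 // size_rpoly.
  by rewrite sk_eq addnS => /addIn.
have un : u != [::].
  by apply: contra_eqN sQ => /eqP ->; rewrite /= size_poly_eq0 monic_neq0.
have au : (0 < 0 :> R) || (u != [::]) by rewrite un orbT.
pose N := (0 *: 'X + 0%:P) * rpoly u - Q.
have NQ : N = - Q by rewrite /N scale0r add0r mul0r sub0r.
have [t Nt ut] := pencil_split (0) uu u0 (lexx 0) au.
have Qt : Q = rpoly t.
  move: Nt; rewrite -/Q -/N NQ lead_coefN (monicP mQ) scaleN1r => /oppr_inj //.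
have st : size t = (size u).-1 by rewrite -sQ Qt size_rpoly.
have u1 : (0 < size u)%N by case: (u) un.
have sut : size (rpoly u) = (size (rpoly t)).+1 by rewrite !size_rpoly st prednK.
have [c] := monic_division_step (monic_rpoly u) (monic_rpoly t) sut.
rewrite size_rpoly ltnS => sr.
exists (t ++ k), c.
(* At a zero [x] of [Q] the weight is [(rpoly u)(x) / Q'(x)], which is negative by the sign of the
   pencil [N = - Q]. *)
have Er := lagrange_wsum ut sr.
set w := (fun x => _) in Er.
have w0 : {in t, forall x, 0 <= - w x}.
  move=> x xt; have Qx : (rpoly t).[x] = 0 by apply/rootP; rewrite root_rpoly.
  have : root N x by rewrite NQ /root hornerN oppr_eq0 Qt Qx.
  move/(pencil_zero_sign uu u0 (lexx 0) au); rewrite -/Q -/N NQ derivN hornerN Qt.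
  rewrite /w hornerD hornerN hornerM Qx mulr0 subr0 mulNr oppr_gt0 => h.
  have dt : (rpoly t)^`().[x] != 0 by apply: contraTneq h => ->; rewrite mul0r ltxx.
  rewrite -(pmulr_lge0 _ (_ : 0 < (rpoly t)^`().[x] ^+ 2)); last first.
    by rewrite exprn_even_gt0.
  have -> : - ((rpoly u).[x] / (rpoly t)^`().[x]) * (rpoly t)^`().[x] ^+ 2
      = - ((rpoly t)^`().[x] * (rpoly u).[x]) by field.
  by rewrite oppr_ge0 ltW.
have [w' w'0 ww'] := cone_cat k ut w0.
exists w'; split=> //; first by rewrite Bk Qt rpoly_cat.
rewrite -ww' (rpoly_perm sk) !rpoly_cat mulrA -mulrBl; congr (_ * _).
have -> : wsum (fun x => - w x) t = - wsum w t.
  by rewrite -scaleN1r -wsumZ; apply: eq_wsum => x _; rewrite mulN1r.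
by rewrite -Er opprK addrC subrK.
Qed.

(** The converse passage: at a zero of the pencil [N], the residue of [rpoly u / N] is
    [rpoly u / N'], which [pencil_zero_sign] makes positive. *)
Lemma cone_pencil t c w : {in t, forall x, 0 <= w x} ->
  exists m, rpoly m = ('X - c%:P) * rpoly t - wsum w t /\ cone m (rpoly t).
Proof.
move=> w0; have [u [k [uu u0 tk ->]]] := wsum_reduce w0.
pose N := (1 *: 'X + (- c)%:P) * rpoly u - wsum w u.
have NE : N = ('X - c%:P) * rpoly u - wsum w u by rewrite /N scale1r polyCN.
have mX : ('X - c%:P) * rpoly u \is monic by rewrite monicMl ?monicXsubC ?monic_rpoly.
have sX : size (('X - c%:P) * rpoly u) = (size u).+2.
  by rewrite -rpoly_cons size_rpoly.
have h : (size (- wsum w u) < size (('X - c%:P) * rpoly u)%R)%N.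
  by rewrite size_polyN sX !ltnS (leq_trans (size_wsum _ _)).
have lN : lead_coef N = 1 by rewrite NE lead_coefDl // (monicP mX).
have au : (0 < 1 :> R) || (u != [::]) by rewrite ltr01.
have [m Nm um] := pencil_split (- c) uu u0 ler01 au.
rewrite -/N lN scale1r in Nm.
have sm : size m = (size u).+1.
  by apply: succn_inj; rewrite -size_rpoly -Nm NE size_polyDl // sX.
exists (m ++ k); split.
  by rewrite (rpoly_perm tk) !rpoly_cat -Nm NE mulrBl mulrA.
have su : (size (rpoly u) <= size m)%N by rewrite size_rpoly sm.
rewrite (rpoly_perm tk) rpoly_cat (lagrange_wsum um su).
apply: cone_cat => // x xm.
have /(pencil_zero_sign uu u0 ler01 au) : root N x by rewrite Nm root_rpoly.
rewrite -/N Nm => dm.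
have d0 : (rpoly m)^`().[x] != 0 by apply: contraTneq dm => ->; rewrite mul0r ltxx.
rewrite -(pmulr_lge0 _ (_ : 0 < (rpoly m)^`().[x] ^+ 2)) ?exprn_even_gt0 //.
have -> : (rpoly u).[x] / (rpoly m)^`().[x] * (rpoly m)^`().[x] ^+ 2
    = (rpoly m)^`().[x] * (rpoly u).[x] by field.
exact: ltW.
Qed.

(** * Counting roots by signs *)

Definition below x s := count (fun y => y <= x) s.
Definition above x s := count (fun y => x < y) s.

Lemma below_perm x s t : perm_eq s t -> below x s = below x t.
Proof. by move=> st; rewrite /below (permP st). Qed.

Lemma below_cat x s t : below x (s ++ t) = (below x s + below x t)%N.
Proof. exact: count_cat. Qed.

Lemma below_above x s : (below x s + above x s = size s)%N.
Proof.
rewrite -(count_predC (fun y => y <= x)); congr (_ + _)%N.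
by apply: eq_count => y /=; rewrite -ltNge.
Qed.

Lemma sign_rpoly s x : x \notin s ->
  0 < (-1) ^+ above x s * (rpoly s).[x].
Proof.
elim: s => [_|y s IHs]; first by rewrite /rpoly big_nil hornerC mulr1 ltr01.
rewrite inE negb_or => /andP[xy /IHs h].
rewrite rpoly_cons hornerM hornerXsubC /= exprD mulrACA mulr_gt0 //.
rewrite neq_lt in xy; case/orP: xy => xy; rewrite ?xy ?(ltNge x y) ?(ltW xy) /=.
  by rewrite expr1 mulN1r opprB subr_gt0.
by rewrite expr0 mul1r subr_gt0.
Qed.

Lemma sign_mul_rpoly s t x : x \notin s -> x \notin t ->
  0 < (-1) ^+ (above x s + above x t) * ((rpoly s).[x] * (rpoly t).[x]).
Proof.
by move=> /sign_rpoly xs /sign_rpoly xt; rewrite exprD mulrACA mulr_gt0.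
Qed.

(** [P] selects the second, fourth, ... entries of a decreasing list. The induction removes the
    smallest entry, which leaves the ranks of the others unchanged. *)
Lemma count_odd_rank (P : pred R) z : sorted >%R z ->
  {in z, forall x, P x = odd (above x z)} ->
  forall x, count (fun y => P y && (x < y)) z = (above x z)./2.
Proof.
elim/last_ind: z => [//|z y IHz].
rewrite -cats1 => sz Pz x.
have zy : {in z, forall x, y < x}.
  move=> e ez; move: sz; rewrite sorted_pairwise; last by move=> a b c /= ba ac; apply: lt_trans ac ba.
  by rewrite pairwise_cat /= allrel1r => /andP[/allP /(_ _ ez)].
have ay e : e \in z -> above e (z ++ [:: y]) = above e z.
  by move=> /zy yv; rewrite /above count_cat /= ltNge ltW // !addn0.
have := IHz _ _ x; rewrite /above !count_cat /= => ->; first last.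
- by move=> e ez; rewrite Pz ?ay // mem_cat ez.
- by have [] := cat_sorted2 sz.
case: ltP => xy; last by rewrite andbF !addn0.
have -> : count [eta <%R x] z = size z.
  by apply/eqP; rewrite -all_count; apply/allP => e /zy; apply: lt_trans.
rewrite Pz ?mem_cat ?inE ?eqxx ?orbT // /above count_cat /= ltxx !addn0.
have -> : count [eta <%R y] z = size z.
  by apply/eqP; rewrite -all_count; apply/allP => e /zy.
by rewrite andbT addn1 [RHS]uphalf_half addnC.
Qed.

(* The sign conditions say that, listing all the roots in decreasing order,
   those of [t] and of [u] alternate, starting with [t]. *)
Lemma alternating_below u t : uniq u -> uniq t -> size u = size t ->
  {in u, forall x, (rpoly u)^`().[x] * (rpoly t).[x] < 0} ->
  {in t, forall x, 0 < (rpoly t)^`().[x] * (rpoly u).[x]} ->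
  forall x, (below x t <= below x u <= (below x t).+1)%N.
Proof.
move=> uu ut sut su st x.
have root0 s y : y \in s -> (rpoly s).[y] = 0 by rewrite -root_rpoly => /rootP.
have disj y : y \in u -> y \notin t.
  by move=> yu; apply: contraTN (su y yu) => /root0 ->; rewrite mulr0 ltxx.
have disj' y : y \in t -> y \notin u.
  by move=> yt; apply: contraTN (st y yt) => /root0 ->; rewrite mulr0 ltxx.
have arem s y : y \in s -> above y (rem y s) = above y s.
  by move=> ys; rewrite /above [RHS](permP (perm_to_rem ys)) /= ltxx.
have urem s y : uniq s -> y \notin rem y s by move=> us; rewrite mem_rem_uniq // !inE eqxx.
(* The number of roots above [y] gives the sign of each factor, so the sign hypothesis becomes a
   parity. *)
have oddu y : y \in u -> odd (above y (u ++ t)).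
  move=> yu; have := sign_mul_rpoly (urem u y uu) (disj y yu).
  rewrite -horner_deriv_rpoly // arem // /above count_cat -signr_odd.
  by case: odd => //; rewrite mul1r ltNge ltW ?su.
have event y : y \in t -> odd (above y (u ++ t)) = false.
  move=> yt; have := sign_mul_rpoly (disj' y yt) (urem t y ut).
  rewrite -horner_deriv_rpoly // arem // /above count_cat -signr_odd.
  by case: odd => //; rewrite mulN1r oppr_gt0 mulrC ltNge ltW ?st.
pose z := rev (sort <=%R (u ++ t)).
have zut : perm_eq z (u ++ t) by rewrite perm_rev perm_sort.
have az y : above y z = above y (u ++ t) by apply/permP.
have sz : sorted >%R z.
  rewrite rev_sorted sort_lt_sorted cat_uniq uu ut andbT /=.
  by apply/hasPn => y /disj'.
have := @count_odd_rank (mem u) z sz _ x; rewrite az => h.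
have {h} au : above x u = (above x (u ++ t))./2.
  rewrite -h => [|y]; last first.
    rewrite az (perm_mem zut) mem_cat => /orP[yu|yt].
      by rewrite oddu //= yu.
    by rewrite event //=; apply/negbTE/disj'.
  rewrite (permP zut) count_cat [X in (_ + X)%N](_ : _ = 0%N) ?addn0.
    by apply: eq_in_count => y yu; rewrite /= yu.
  apply/eqP; rewrite -leqn0 leqNgt -has_count; apply/hasPn => y /disj' yu.
  by rewrite /= (negbTE yu).
(* As [above x u] is half the total rounded down, [above x t] equals it or exceeds it by one; equal
   sizes turn this into the claim on [below]. *)
have := below_above x u; have := below_above x t.
by move: au; rewrite /above count_cat -/(above x u) -/(above x t); lia.
Qed.

(** After cancelling the common factor [k], the quotient is the pencil with [a = 0] and [b = 1],
    whose signs at poles and zeros make the roots alternate. If [u] is empty, then [B = 0] and no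
    root moves. *)
Lemma cone_shift_below m m' B : cone m B -> rpoly m' = rpoly m - B ->
  forall x, (below x m' <= below x m <= (below x m').+1)%N.
Proof.
move=> [v v0 ->] em x; have [u [k [uu u0 mk Bk]]] := wsum_reduce v0.
have [u_nil|un] := eqVneq u [::].
  rewrite (@below_perm x m m') ?leqnn ?leqnSn //.
  apply: rpoly_inj; rewrite em Bk u_nil /wsum big_nil mul0r subr0 //.
have au : (0 < 0 :> R) || (u != [::]) by rewrite un orbT.
pose N := (0 *: 'X + 1%:P) * rpoly u - wsum v u.
have NE : N = rpoly u - wsum v u by rewrite /N scale0r add0r mul1r.
have [mN sN] := monic_pencil v (monic_rpoly u) (size_rpoly u); rewrite -NE in mN sN.
have [t Nt ut] := pencil_split (1) uu u0 (lexx 0) au.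
rewrite -/N (monicP mN) scale1r in Nt.
have tk : perm_eq m' (t ++ k).
  by apply: rpoly_inj; rewrite em Bk (rpoly_perm mk) !rpoly_cat -mulrBl -NE Nt.
have st : size u = size t by apply: succn_inj; rewrite -!size_rpoly -Nt sN size_rpoly.
rewrite (below_perm x mk) (below_perm x tk) !below_cat -addSn !leq_add2r.
apply: alternating_below => // y yu.
  by rewrite -Nt; apply: (pencil_pole_sign 0 1 uu u0).
rewrite -{1}Nt; apply: (pencil_zero_sign uu u0 (lexx 0) au).
by rewrite -/N Nt root_rpoly.
Qed.

End Cone.

(** * The convolution as a differential operator *)

Section Convolution.
Variable R : realType.
Implicit Types (p q r f g : {poly R}) (s t u m : seq R).

(* [p |-> p [+]_d r] written as a differential operator. *)
Definition diffop d r p : {poly R} :=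
  \sum_(b < d.+1) (r`_b * b`!%:R / d`!%:R) *: p^`(d - b).

Lemma natf_neq0 n : (n`!)%:R != 0 :> R.
Proof. by rewrite pnatr_eq0 -lt0n fact_gt0. Qed.

Lemma binR n k : (k <= n)%N ->
  ('C(n, k))%:R = (n`!)%:R / ((k`!)%:R * ((n - k)`!)%:R) :> R.
Proof.
move=> kn; rewrite -(bin_fact kn) !natrM mulfK //.
by rewrite mulf_neq0 ?natf_neq0.
Qed.

Lemma ffactR n k : (k <= n)%N -> (n ^_ k)%:R = (n`!)%:R / ((n - k)`!)%:R :> R.
Proof. by move=> kn; rewrite -(ffact_fact kn) natrM mulfK ?natf_neq0. Qed.

Lemma ffconv_diffop d p r : (size p <= d.+1)%N -> ffconv d p r = diffop d r p.
Proof.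
move=> sp; apply/polyP => m.
(* [c j] is the coefficient of [X^j], the summation index being [k = d - j]. *)
pose c (j : nat) := (-1) ^+ (d - j) * ('C(d, d - j))%:R *
  \sum_(i < (d - j).+1) ('C(d - j, i))%:R * etilde d p i * etilde d r (d - j - i).
have -> : ffconv d p r = \poly_(j < d.+1) c j.
  rewrite poly_def /ffconv (reindex_inj rev_ord_inj) /=.
  by apply: eq_bigr => k _; rewrite subSS subKn -1?ltnS.
rewrite coef_poly /c.
rewrite coef_sum.
under [RHS]eq_bigr => b _ do rewrite coefZ coef_derivn.
case: ltnP => md; last first.
  rewrite big1 // => b _; rewrite [p`__]nth_default ?mul0rn ?mulr0 //.
  by rewrite (leq_trans sp) // (leq_trans md) ?leq_addl.
rewrite -(big_mkord xpredT (fun b => (r`_b * b`!%:R / d`!%:R) *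
   (p`_(d - b + m) *+ (d - b + m) ^_ (d - b)))).
(* Terms with [b < m] involve coefficients of [p] beyond degree [d]; in the others [b = i + m]. *)
rewrite (@big_cat_nat _ _ _ m) //=; last by lia.
rewrite [X in _ = X + _]big_nat_cond [X in _ = X + _]big1 ?add0r; last first.
  move=> b; rewrite andbT => bm.
  by rewrite [p`__]nth_default ?mul0rn ?mulr0 // (leq_trans sp) //; lia.
rewrite (big_addn 0 d.+1 m) subSn -1?ltnS // big_mkord mulr_sumr.
apply: eq_bigr => -[i ilt] _ /=.
rewrite /etilde.
have -> : (d - (d - m - i) = i + m)%N by lia.
have -> : (d - (i + m) = d - m - i)%N by lia.
have -> : (d - m - i + m = d - i)%N by lia.
rewrite -[_ *+ _ ^_ _]mulr_natr !binR ?ffactR; try lia.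
have -> : (d - (d - m) = m)%N by lia.
have -> : (d - (d - m - i) = i + m)%N by lia.
have -> : (d - i - (d - m - i) = m)%N by lia.
have -> : (-1) ^+ (d - m) = (-1) ^+ i * (-1) ^+ (d - m - i) :> R.
  by rewrite -exprD; congr (_ ^+ _); lia.
set e1 := (-1) ^+ i; set e2 := (-1) ^+ (d - m - i).
have h1 : e1 * e1 = 1 by rewrite -expr2 sqrr_sign.
have h2 : e2 * e2 = 1 by rewrite -expr2 sqrr_sign.
transitivity ((e1 * e1) * (e2 * e2) * (r`_(i + m) * (i + m)`!%:R / d`!%:R *
  (p`_(d - i) * ((d - i)`!%:R / m`!%:R)))); last by rewrite h1 h2 !mul1r.
by field; rewrite !natf_neq0.
Qed.

Lemma ffconvC d p q : ffconv d p q = ffconv d q p.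
Proof.
apply: eq_bigr => k _; congr (_ * _ *: _).
rewrite (reindex_inj rev_ord_inj) /=; apply: eq_bigr => i _.
have ik : (i <= k)%N by rewrite -ltnS.
by rewrite subSS bin_sub // subKn // mulrAC.
Qed.

Lemma diffopB d r p q : diffop d r (p - q) = diffop d r p - diffop d r q.
Proof. by rewrite -sumrB; apply: eq_bigr => b _; rewrite derivnB scalerBr. Qed.

Lemma diffopZ d r a p : diffop d r (a *: p) = a *: diffop d r p.
Proof.
rewrite scaler_sumr; apply: eq_bigr => b _.
by rewrite derivnZ !scalerA mulrC.
Qed.

Lemma diffop_symB d r q p : diffop d (r - q) p = diffop d r p - diffop d q p.
Proof.
by rewrite -sumrB; apply: eq_bigr => b _; rewrite coefB !mulrBl scalerBl.
Qed.

Lemma diffop_symZ d a r p : diffop d (a *: r) p = a *: diffop d r p.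
Proof.
by rewrite scaler_sumr; apply: eq_bigr => b _; rewrite coefZ -!mulrA scalerA.
Qed.

Lemma diffop_sym_sum d (I : Type) (l : seq I) (F : I -> {poly R}) p :
  diffop d (\sum_(i <- l) F i) p = \sum_(i <- l) diffop d (F i) p.
Proof.
rewrite exchange_big /=; apply: eq_bigr => b _.
by rewrite coef_sum !mulr_suml scaler_suml.
Qed.

Lemma diffop_comp_shift d r p e :
  diffop d r (p \Po ('X - e%:P)) = diffop d r p \Po ('X - e%:P).
Proof.
rewrite /diffop raddf_sum /=; apply: eq_bigr => b _.
rewrite comp_polyZ; congr (_ *: _).
elim: (d - b)%N => [|n IHn]; first by rewrite !derivn0.
by rewrite !derivnS IHn deriv_comp derivXsubC mulr1.
Qed.

Definition normalized_deriv d r : {poly R} := d.+1%:R^-1 *: r^`().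

Lemma diffop_deriv d r f : (size f <= d.+1)%N ->
  diffop d.+1 r f = diffop d (normalized_deriv d r) f.
Proof.
move=> sf; rewrite /diffop big_ord_recl subn0 derivn_poly0 // scaler0 add0r.
apply: eq_bigr => b _; rewrite lift0 subSS; congr (_ *: _).
rewrite coefZ coef_deriv !factS !natrM -mulr_natr.
by field; rewrite natf_neq0 nat1r pnatr_eq0.
Qed.

Lemma diffop_mulX d r f : (size f <= d.+1)%N ->
  diffop d.+1 r ('X * f) = 'X * diffop d (normalized_deriv d r) f
    + diffop d (r - 'X * normalized_deriv d r) f.
Proof.
move=> sf; rewrite -diffop_deriv // /diffop big_ord_recr /= subnn derivn0.
rewrite [in X in _ = 'X * X + _]big_ord_recr /= subnn derivn0 mulrDr -scalerAr.
rewrite -addrA [X in _ = _ + X]addrC addrA; congr (_ + _).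
rewrite mulr_sumr -big_split; apply: eq_bigr => b _ /=.
rewrite subSn -1?ltnS //; set n := (d - b)%N.
have -> : ('X * f)^`(n.+1) = 'X * f^`(n.+1) + f^`(n) *+ n.+1.
  by rewrite mulrC -[_ * _]addr0 -polyC0 derivnMXaddC addrC mulrC.
rewrite scalerDr scalerAr; congr (_ + _).
rewrite -scaler_nat scalerA; congr (_ *: _).
rewrite coefB coefXM coefZ coef_deriv factS natrM.
have -> : (if (b == 0 :> nat)%N then 0 else d.+1%:R^-1 * (r`_b.-1.+1 *+ b.-1.+1))
     = d.+1%:R^-1 * (r`_b * b%:R).
  by case: (nat_of_ord b) => [|b'] /=; rewrite ?mulr0 // mulr_natr.
have -> : n.+1%:R = d.+1%:R - b%:R :> R.
  by rewrite -natrB; [congr (_%:R); rewrite /n; have := ltn_ord b; lia|rewrite ltnW].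
by field; rewrite natf_neq0 nat1r pnatr_eq0.
Qed.

(** * Real roots and interlacing for the convolution *)

Lemma monic_normalized_deriv d r : r \is monic -> size r = d.+2 ->
  normalized_deriv d r \is monic /\ size (normalized_deriv d r) = d.+1.
Proof.
move=> mr sr; have rd : (normalized_deriv d r)`_d = 1.
  rewrite coefZ coef_deriv; move/monicP: mr; rewrite lead_coefE sr /= => ->.
  by rewrite mulVf ?pnatr_eq0.
have sd : size (normalized_deriv d r) = d.+1.
  apply/eqP; rewrite eqn_leq; apply/andP; split.
    rewrite (leq_trans (size_scale_leq _ _)) // -ltnS -sr lt_size_deriv //.
    by rewrite -size_poly_eq0 sr.
  by rewrite ltnNge; apply/negP => /leq_sizeP/(_ _ (leqnn _))/eqP; rewrite rd oner_eq0.
by split=> //; rewrite monicE lead_coefE sd rd.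
Qed.

Lemma cone_normalized_deriv d t : cone t (normalized_deriv d (rpoly t)).
Proof.
apply: coneZ; first by rewrite invr_ge0.
by exists (fun x => (count_mem x t)%:R) => //; exact: deriv_rpoly_wsum.
Qed.

(** The two claims are proved together: real-rootedness in one degree uses interlacing in the degree
    below. *)
Lemma ffconv_roots d s t : size s = d -> size t = d ->
  exists m, ffconv d (rpoly s) (rpoly t) = rpoly m /\
    {in s, forall a, cone m (ffconv d (rpoly (rem a s)) (rpoly t))}.
Proof.
elim: d s t => [|d IHd] s t.
  move=> /size0nil -> /size0nil ->; exists [::]; split=> //.
  rewrite ffconv_diffop ?size_rpoly // /diffop big_ord1 /rpoly big_nil.
  by rewrite derivn0 coefC eqxx fact0 divr1 mulr1 scale1r.
move=> ss st.
(* Treating the first root suffices: bringing another root to the front only permutes [m]. *)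
suff step a (l : seq R) : size l = d -> exists m,
    ffconv d.+1 (rpoly (a :: l)) (rpoly t) = rpoly m /\
    cone m (ffconv d.+1 (rpoly l) (rpoly t)).
  case: s ss => // x s [ss]; have [m [em _]] := step x s ss.
  exists m; split=> // a axs; have sr : size (rem a (x :: s)) = d.
    by rewrite size_rem //= ss.
  have [m' [em' cm']] := step a _ sr; apply: cone_perm cm'; apply: rpoly_inj.
  by rewrite -em -em'; congr ffconv; apply/esym/rpoly_perm/perm_to_rem.
move=> sl; pose g := normalized_deriv d (rpoly t).
have [mg sg] : g \is monic /\ size g = d.+1.
  by apply: monic_normalized_deriv; rewrite ?monic_rpoly ?size_rpoly ?st.
have [y [c [w [gy w0 ty]]]] : exists y c w, [/\ g = rpoly y,
    {in y, forall x, 0 <= w x} & rpoly t = ('X - c%:P) * rpoly y - wsum w y].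
  by apply: cone_quotient; rewrite ?st //; apply: cone_normalized_deriv.
have sy : size y = d by apply: succn_inj; rewrite -sg gy size_rpoly.
(* The lists are exchanged, so that interlacing is available for the removal of a root of [y]. *)
have [n [en cn]] := IHd y l sy sl.
have sld : (size (rpoly l) <= d.+1)%N by rewrite size_rpoly sl.
have Gn : diffop d g (rpoly l) = rpoly n by rewrite -ffconv_diffop // ffconvC gy.
have [w' w'0 ew'] : cone n (diffop d (wsum w y) (rpoly l)).
  rewrite diffop_sym_sum; apply: cone_sum => x; rewrite mem_undup => xy.
  by rewrite diffop_symZ -ffconv_diffop // ffconvC; apply: coneZ; [exact: w0|exact: cn].
have [m [em cm]] := cone_pencil (a + c) w'0.
exists m; split; last by rewrite ffconv_diffop ?(leq_trans sld) // diffop_deriv // Gn.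
rewrite ffconv_diffop ?size_rpoly ?sl //= ?sl //.
(* Since [rpoly t - X g = - c g - wsum w y], the factor [X - a] yields a pencil over [n] with shift
   [a + c]. *)
rewrite rpoly_cons mulrBl mul_polyC diffopB diffopZ diffop_mulX // diffop_deriv //.
rewrite -/g Gn ty -gy; have -> : ('X - c%:P) * g - wsum w y - 'X * g = (- c) *: g - wsum w y.
  by rewrite -mul_polyC polyCN; ring.
rewrite diffop_symB diffop_symZ Gn ew' em -!mul_polyC polyCN polyCD; ring.
Qed.

(** The list [s] itself qualifies, so the default [[::]] is not what selects the roots; unique
    factorization then fixes them up to order. *)
Lemma rootseq_rpoly s : perm_eq (rootseq (rpoly s)) s.
Proof.
apply: rpoly_inj; apply/esym.
by apply: (@xgetPex _ [::] [set s' | has_roots (rpoly s) s']%classic); exists s.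
Qed.

(** * Moving the roots of one factor *)

Section RootCount.
Variables (t : seq R) (x : R).

Definition conv_below s :=
  below x (rootseq (ffconv (size t) (rpoly s) (rpoly t))).

Lemma conv_below_perm s u : perm_eq s u -> conv_below s = conv_below u.
Proof. by move=> su; rewrite /conv_below (rpoly_perm su). Qed.

(** By linearity, raising [a] to [b] subtracts [b - a] times the convolution of [rpoly s], which
    lies in the cone of the old roots. *)
Lemma conv_below_replace a b s : size t = (size s).+1 -> a <= b ->
  (conv_below (b :: s) <= conv_below (a :: s) <= (conv_below (b :: s)).+1)%N.
Proof.
move=> ts ab; have [ma [ea ca]] := ffconv_roots (esym ts : size (a :: s) = _) erefl.
have [mb [eb _]] := ffconv_roots (esym ts : size (b :: s) = _) erefl.
have := ca a (mem_head _ _); rewrite /= eqxx => {}ca.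
rewrite /conv_below ea eb !(below_perm _ (rootseq_rpoly _)).
apply: (cone_shift_below (coneZ (_ : 0 <= b - a) ca)); first by rewrite subr_ge0.
rewrite -ea -eb !ffconv_diffop ?size_rpoly ?ts //=.
rewrite -diffopZ -diffopB; congr diffop.
by rewrite !rpoly_cons scalerBl -!mul_polyC; ring.
Qed.

(** The roots are lowered one at a time; [k] collects those already moved. *)
Lemma conv_below_mono s u k : size t = (size s + size k)%N ->
  all2 <=%R u s -> (conv_below (s ++ k) <= conv_below (u ++ k))%N.
Proof.
elim: s u k => [|a s IHs] [|b u] k //= ts /andP[ba us].
have sk : size t = (size (s ++ k)).+1 by rewrite size_cat ts.
have /andP[h _] := conv_below_replace sk ba.
apply: leq_trans h _.
have mid v : perm_eq (b :: v ++ k) (v ++ b :: k).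
  by rewrite -cat1s perm_catCA.
rewrite (conv_below_perm (mid s)) (conv_below_perm (mid u)).
by apply: IHs => //=; rewrite ts addnS.
Qed.

(** Each replacement costs at most one unit, whichever way the root moves. *)
Lemma conv_below_leq_add s u k : size t = (size s + size k)%N ->
  size s = size u -> (conv_below (s ++ k) <= conv_below (u ++ k) + size s)%N.
Proof.
elim: s u k => [|a s IHs] [|b u] k //= ts; first by rewrite addn0.
move=> [su].
have sk : size t = (size (s ++ k)).+1 by rewrite size_cat ts.
have h : (conv_below (a :: s ++ k) <= (conv_below (b :: s ++ k)).+1)%N.
  have [ab|/ltW ab] := leP a b.
    by have /andP[_] := conv_below_replace sk ab.
  have /andP[h _] := conv_below_replace sk ab.
  by rewrite (leq_trans h).
apply: leq_trans h _; rewrite addnS ltnS.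
have mid v : perm_eq (b :: v ++ k) (v ++ b :: k).
  by rewrite -cat1s perm_catCA.
rewrite (conv_below_perm (mid s)) (conv_below_perm (mid u)).
by apply: IHs => //=; rewrite ts addnS.
Qed.

(** Otherwise, for [z = s_(i + n)], at least [i + n + 1] entries of [s] but at most [i] entries of
    [u] are below [z]. *)
Lemma below_sorted_le s u n i : sorted <=%R s -> sorted <=%R u ->
  (forall z, (below z s <= below z u + n)%N) ->
  (i + n < size s)%N -> (i < size u)%N -> u`_i <= s`_(i + n).
Proof.
move=> ss su h ins iu; rewrite leNgt; apply/negP => lt.
set z := s`_(i + n) in lt.
have split j l : below z l = (below z (take j l) + below z (drop j l))%N.
  by rewrite -below_cat cat_take_drop.
have hu : (below z u <= i)%N.
  rewrite (split i) [below z (drop i u)](_ : _ = 0%N) ?addn0.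
    by rewrite (leq_trans (count_size _ _)) // size_take; case: ltnP.
  apply/eqP; rewrite -leqn0 leqNgt -has_count -all_predC.
  apply/(all_nthP 0) => j; rewrite size_drop => ju.
  rewrite nth_drop /= -ltNge; apply: lt_le_trans lt _.
  by apply: (sorted_leq_nth le_trans lexx); rewrite ?inE ?leq_addr ?iu -?ltn_subRL.
have hs : (i + n < below z s)%N.
  rewrite (split (i + n).+1) ltn_addr //.
  suff -> : below z (take (i + n).+1 s) = (i + n).+1 by [].
  rewrite -[RHS](size_takel ins); apply/eqP; rewrite -all_count.
  apply/(all_nthP 0) => j; rewrite size_takel // => ji.
  rewrite nth_take //=.
  by apply: (sorted_leq_nth le_trans lexx); rewrite ?inE ?ins ?(leq_trans ji ins).
by have := leq_trans hs (h z); rewrite ltnNge leq_add2r hu.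
Qed.

(* With both lists sorted, move [s_(i + n)] down to [u_i], which cannot decrease
   the count; then replace the [n] roots left over arbitrarily, losing at most
   one unit each time. *)
Lemma conv_below_lipschitz s u n : size s = size t -> size u = size t ->
  (forall z, (below z s <= below z u + n)%N) ->
  (conv_below s <= conv_below u + n)%N.
Proof.
move=> ss su h; pose s' := sort <=%R s; pose u' := sort <=%R u.
have ps : perm_eq s' s by rewrite perm_sort.
have pu : perm_eq u' u by rewrite perm_sort.
have ss' : size s' = size t by rewrite size_sort.
have su' : size u' = size t by rewrite size_sort.
have h' z : (below z s' <= below z u' + n)%N.
  by rewrite (below_perm z ps) (below_perm z pu).
rewrite -(conv_below_perm ps) -(conv_below_perm pu).
have sos : sorted <=%R s' by exact: sort_le_sorted.
have sou : sorted <=%R u' by exact: sort_le_sorted.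
rewrite -(conv_below_perm (_ : perm_eq (drop n s' ++ take n s') _)); last first.
  by rewrite perm_catC cat_take_drop.
(* For [n >= size t] both lists are empty. *)
have le1 : all2 <=%R (take (size t - n) u') (drop n s').
  rewrite all2E size_drop ss' size_takel ?su' ?leq_subr // eqxx /=.
  apply/(all_nthP (0, 0)) => i; rewrite size_zip size_drop ss' size_takel ?su' ?leq_subr //.
  rewrite minnn => it; rewrite nth_zip ?size_drop ?ss' ?size_takel ?su' ?leq_subr //=.
  rewrite nth_drop nth_take // addnC.
  apply: below_sorted_le => //; first by rewrite ss' addnC -ltn_subRL.
  by rewrite su' (leq_trans it) ?leq_subr.
apply: leq_trans (conv_below_mono _ le1) _.
  by rewrite addnC -size_cat cat_take_drop ss'.
have stake : size (take n s') = size (drop (size t - n) u').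
  by rewrite size_drop su' size_take ss'; case: ltnP; lia.
rewrite -(conv_below_perm (_ : perm_eq (take n s' ++ take (size t - n) u') _)); last first.
  by rewrite perm_catC.
apply: leq_trans (conv_below_leq_add _ stake) _.
  by rewrite stake addnC -size_cat cat_take_drop su'.
rewrite (conv_below_perm (_ : perm_eq (_ ++ _) u')); last by rewrite perm_catC cat_take_drop.
by rewrite leq_add2l size_take; case: ltnP => // /ltnW.
Qed.

End RootCount.

(** * From root counts to the two distances *)

Lemma cdf_rpoly d s x : cdf d (rpoly s) x = (below x s)%:R / d%:R.
Proof. by rewrite /cdf -/(below x _) (below_perm x (rootseq_rpoly s)). Qed.

(** Counts are integers, so the bound [d * e] on their difference can be rounded down to a natural
    number. *)
Lemma cdf_ffconv_lipschitz d s u t e : (0 < d)%N ->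
  size s = d -> size u = d -> size t = d -> 0 <= e ->
  (forall x, cdf d (rpoly s) x <= cdf d (rpoly u) x + e) ->
  forall x, cdf d (ffconv d (rpoly s) (rpoly t)) x
         <= cdf d (ffconv d (rpoly u) (rpoly t)) x + e.
Proof.
move=> d0 ss su st e0 h x.
have d0R : 0 < d%:R :> R by rewrite ltr0n.
have de : 0 <= d%:R * e by rewrite mulr_ge0 ?ler0n.
pose n := Num.truncn (d%:R * e).
have : (conv_below t x s <= conv_below t x u + n)%N.
  apply: conv_below_lipschitz; rewrite ?ss ?su // => z.
  rewrite -leq_subLR /n truncn_ge_nat //.
  have := h z; rewrite !cdf_rpoly -(ler_pM2l d0R) mulrDr !mulrA.
  rewrite ![d%:R * _]mulrC !mulfK ?gt_eqF // [e * _]mulrC => hz.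
  have [us|/ltnW us] := leqP (below z u) (below z s); first by rewrite natrB // lerBlDl.
  by rewrite (eqP (us : (_ - _ == 0)%N)).
rewrite -(ler_nat R) natrD => hx.
rewrite /cdf -/(below x _) -/(below x _) -(ler_pM2l d0R) mulrDr !mulrA.
rewrite ![d%:R * _%:R]mulrC !mulfK ?gt_eqF //.
rewrite /conv_below st in hx; apply: le_trans hx _.
by rewrite lerD2l truncn_le.
Qed.

(** Inclusion of the sets of admissible [e] compares the infima once the smaller set is nonempty,
    which the first hypothesis ensures. *)
Lemma dK_le (F G F' G' : R -> R) :
  (exists2 e, 0 < e & forall x, F x - e <= G x /\ G x <= F x + e) ->
  (forall e, 0 < e -> (forall x, F x - e <= G x /\ G x <= F x + e) ->
     forall x, F' x - e <= G' x /\ G' x <= F' x + e) ->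
  dK F' G' <= dK F G.
Proof.
move=> [e0 e00 he0] H; apply: lb_le_inf; first by exists e0.
move=> e [e1 he]; apply: ge_inf; last by split=> // ; apply: H.
by exists 0 => y [/ltW].
Qed.

Lemma dL_le (F G F' G' : R -> R) :
  (exists2 e, 0 < e & forall x, F (x - e) - e <= G x /\ G x <= F (x + e) + e) ->
  (forall e, 0 < e -> (forall x, F (x - e) - e <= G x /\ G x <= F (x + e) + e) ->
     forall x, F' (x - e) - e <= G' x /\ G' x <= F' (x + e) + e) ->
  dL F' G' <= dL F G.
Proof.
move=> [e0 e00 he0] H; apply: lb_le_inf; first by exists e0.
move=> e [e1 he]; apply: ge_inf; last by split=> // ; apply: H.
by exists 0 => y [/ltW].
Qed.

Definition shift_roots (e : R) s := [seq a + e | a <- s].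

Lemma rpoly_shift e s : rpoly (shift_roots e s) = rpoly s \Po ('X - e%:P).
Proof.
rewrite /rpoly /shift_roots big_map; elim: s => [|a s IHs].
  by rewrite !big_nil comp_polyC.
rewrite !big_cons IHs comp_polyM comp_polyB comp_polyX comp_polyC polyCD.
by congr (_ * _); ring.
Qed.

Lemma below_shift x e s : below x (shift_roots e s) = below (x - e) s.
Proof. by rewrite /below count_map; apply: eq_count => y /=; rewrite lerBrDr. Qed.

Lemma cdf_shift d e s x : cdf d (rpoly (shift_roots e s)) x = cdf d (rpoly s) (x - e).
Proof. by rewrite !cdf_rpoly below_shift. Qed.

(** Translations commute with derivatives, hence with convolution by [rpoly t]. *)
Lemma cdf_ffconv_shift d e s t x : size s = d -> size t = d ->
  cdf d (ffconv d (rpoly (shift_roots e s)) (rpoly t)) x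
    = cdf d (ffconv d (rpoly s) (rpoly t)) (x - e).
Proof.
move=> ss st; have [m [em _]] := ffconv_roots ss st.
rewrite em -cdf_shift (rpoly_shift e m); congr (cdf d _ x).
rewrite -em !ffconv_diffop ?rpoly_shift ?size_rpoly ?ss //.
  exact: diffop_comp_shift.
by rewrite -rpoly_shift size_rpoly size_map ss.
Qed.

Lemma cdf_ge0 d p x : 0 <= cdf d p x.
Proof. by rewrite divr_ge0 ?ler0n. Qed.

Lemma cdf_le1 d s x : size s = d -> cdf d (rpoly s) x <= 1.
Proof.
move=> ss; rewrite cdf_rpoly; have [->|d0] := eqVneq d 0%N; first by rewrite invr0 mulr0.
by rewrite ler_pdivrMr ?ltr0n ?lt0n // mul1r ler_nat -ss count_size.
Qed.

End Convolution.

Theorem theorem1p2 (R : realType) (d : nat) (hd : (0 < d)%N)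
    (p q r : {poly R}) (hp : Pd d p) (hq : Pd d q) (hr : Pd d r) :
  dKp d (ffconv d p r) (ffconv d q r) <= dKp d p q /\
  dLp d (ffconv d p r) (ffconv d q r) <= dLp d p q.
Proof.
case: hp hq hr => s [ss ->] [u [su ->]] [t [st ->]].
rewrite -!/(rpoly _).
have lip s' u' e := @cdf_ffconv_lipschitz _ d s' u' t e hd.
have s01 x : 0 <= cdf d (rpoly s) x <= 1 by rewrite cdf_ge0 cdf_le1.
have u01 x : 0 <= cdf d (rpoly u) x <= 1 by rewrite cdf_ge0 cdf_le1.
split.
  apply: dK_le.
    (* Distribution functions take values in [[0, 1]], so [1] is admissible. *)
    by exists 1 => // x; move: (s01 x) (u01 x); lra.
  move=> e /ltW e0 he x; split.
    rewrite lerBlDr; apply: lip => // y.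
    by rewrite -lerBlDr; case: (he y).
  by apply: lip => // y; case: (he y).
have sh e v : size v = d -> size (shift_roots e v) = d by rewrite size_map.
apply: dL_le.
  by exists 1 => // x; move: (s01 (x - 1)) (s01 (x + 1)) (u01 x); lra.
(* Evaluation at [x - e] amounts to translating the roots by [e], which turns each Lévy inequality
   into a one-sided bound; [s] is translated in the first, [u] in the second. *)
move=> e /ltW e0 he x; split.
  rewrite lerBlDr -cdf_ffconv_shift //; apply: lip => // [|y]; first exact: sh.
  by rewrite cdf_shift -lerBlDr; case: (he y).
rewrite -[x in cdf _ _ x <= _](addrK e) -cdf_ffconv_shift //.
apply: lip => // [|y]; first exact: sh.
by rewrite cdf_shift; have [_] := he (y - e); rewrite subrK.
Qed.
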